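(* Let $(Y,\tau_Y)$ be a quasi-$\ell_\infty$-barrelled Hausdorff locally convex topological vector space, assume that its strong dual $(X,\tau_X):=(Y',\beta(Y',Y))$ is a separable Fréchet space, and let $T:X\to X$ be a continuous linear operator that is the adjoint of some linear map $S:Y\to Y$. Then: (1) For every vector $x_0\in \mathrm{RRec}(T)\cap \ell\mathit{bo}(T)$ there exists a $T$-invariant probability measure $\mu_{x_0}$ on $(X,\mathscr{B}(X))$ such that $$x_0\in \operatorname{supp}(\mu_{x_0})\subset \overline{\{T^n x_0 : n\ge 1\}}^{\,\sigma(X,Y)},$$ and if $x_0\neq 0$ then $\mu_{x_0}$ can be found non-trivial. (2) If the set $\mathrm{RRec}(T)\cap \ell\mathit{bo}(T)$ is dense in $X$, then there exists a $T$-invariant probability measure $\mu$ on $(X,\mathscr{B}(X))$ with full support. In particular, if $(X,\tau_X)$ is a separable reflexive Fréchet space, then conclusions (1) and (2) hold for every continuous linear operator $T:X\to X$, with the weak topology $\sigma(X,X')$ in place of $\sigma(X,Y)$ in (1).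
   Context: Vector spaces are over $\mathbb{K}=\mathbb{R}$ or $\mathbb{C}$; $\mathbb{N}$ is the set of positive integers. A Fréchet space is a locally convex, completely metrizable topological vector space. Duality. For a Hausdorff locally convex space $(Y,\tau_Y)$ with topological dual $Y'$ and pairing $\langle u,x\rangle$ ($u\in Y$, $x\in Y'$), the strong topology $\beta(Y',Y)$ on $Y'$ is the locally convex topology having as a basis of $0$-neighbourhoods the polars $E^\circ=\{x\in Y' : |\langle u,x\rangle|\le 1 \text{ for all } u\in E\}$ with $E\subset Y$ bounded; $(Y',\beta(Y',Y))$ is the strong dual of $(Y,\tau_Y)$. With $X=Y'$, $\sigma(X,Y)$ denotes the weak topology on $X$ induced by $Y$ (i.e. the weak-star topology). $(Y,\tau_Y)$ is quasi-$\ell_\infty$-barrelled if every bounded sequence in its strong dual is equicontinuous. ''$T$ is the adjoint of $S:Y\to Y$'' means $\langle Su,x\rangle=\langle u,Tx\rangle$ for all $(u,x)\in Y\times X$. A Fréchet space $X$ is reflexive if the canonical inclusion of $X$ into its strong bidual is an isomorphism of topological vector spaces. Dynamics. For $x\in X$ and $E\subset X$ let $\mathcal{N}_T(x,E)=\{n\in\mathbb{N} : T^nx\in E\}$. The upper Banach density of $A\subset\mathbb{N}$ is $$\overline{\mathrm{Bd}}(A)=\limsup_{N\to\infty}\Big(\max_{m\ge 0}\frac{\#(A\cap[m+1,m+N])}{N}\Big).$$ $\mathrm{RRec}(T)$ is the set of reiteratively recurrent vectors: those $x\in X$ with $\overline{\mathrm{Bd}}(\mathcal{N}_T(x,U))>0$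 for every neighbourhood $U$ of $x$. A vector $x\in X$ has a locally bounded orbit for $T$ if there is a neighbourhood $U$ of $x$ such that $U\cap\{T^nx : n\ge 1\}$ is a bounded set in $X$; $\ell\mathit{bo}(T)$ denotes the set of such vectors. Neighbourhoods, boundedness and density in $X$ refer to $\tau_X$. Measures. $\mathscr{B}(X)$ is the Borel $\sigma$-algebra of $(X,\tau_X)$. A measure $\mu$ on $(X,\mathscr{B}(X))$ is $T$-invariant if $\mu(A)=\mu(T^{-1}(A))$ for all $A\in\mathscr{B}(X)$. $\operatorname{supp}(\mu)$ is the complement of the union of all $\tau_X$-open sets of $\mu$-measure $0$; $\mu$ has full support if $\mu(U)>0$ for every non-empty $\tau_X$-open $U$. A probability measure is non-trivial if it differs from the Dirac mass $\delta_0$. *)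

(* Defs.v *)
From HB Require Import structures.
From mathcomp Require Import all_boot all_order all_algebra.
From mathcomp Require Import complex.
From mathcomp Require Import all_classical all_reals all_analysis.

Set Implicit Arguments.
Unset Strict Implicit.
Unset Printing Implicit Defensive.

Import Order.TTheory GRing.Theory Num.Theory.
Import numFieldTopology.Exports numFieldNormedType.Exports.

Local Open Scope classical_set_scope.
Local Open Scope ring_scope.

Variant real_or_complex (R : realType) : numFieldType -> Prop :=
  | scalars_real : real_or_complex R R
  | scalars_complex : real_or_complex R R[i].

Section topological_notions.

Definition separable_space (X : topologicalType) :=
  exists2 D : set X, countable D & dense D.

Definition completely_metrizable (R : realType) (X : topologicalType) :=
  exists d : X -> X -> R,
    [/\ forall x y, d x y = 0 <-> x = y,
        forall x y, d x y = d y x,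
        forall x y z, d x z <= d x y + d y z,
        forall x (A : set X), nbhs x A <->
          exists2 e : R, 0 < e & [set y | d x y < e] `<=` A
      & forall u : nat -> X,
          (forall e : R, 0 < e -> exists N, forall m n,
             (N <= m)%N -> (N <= n)%N -> d (u m) (u n) < e) ->
          exists l : X, u @ \oo --> l].

(* Local convexity is part of the structure tvsType. The uniform structure
   carried by a tvsType is not required to be the translation-invariant one,
   so completeness is expressed with the metric. *)
Definition frechet_space (R : realType) (K : numFieldType) (X : tvsType K) :=
  completely_metrizable R X.

(* The library's bounded_set is only available for normed modules. *)
Definition tvs_bounded (K : numFieldType) (X : tvsType K) (E : set X) :=
  forall U : set X, nbhs 0 U ->
    exists2 s : K, 0 < s & forall t : K, s <= `|t| -> E `<=` *:%R t @` U.

End topological_notions.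

Section bounded_sets.
Context (K : numFieldType) (X : tvsType K).
Implicit Types E F : set X.

Lemma tvs_bounded0 : tvs_bounded (@set0 X).
Proof. by move=> U _; exists 1 => // t _ x. Qed.

Lemma tvs_bounded_eventually E (U : set X) : tvs_bounded E -> nbhs 0 U ->
  exists2 s : K, 0 < s & forall t, s <= `|t| -> forall x, E x -> U (t^-1 *: x).
Proof.
move=> bE /bE[s s0 sE]; exists s => // t st x /(sE t st)[u Uu <-].
by rewrite scalerA mulVf ?scale1r// -normr_gt0 (lt_le_trans s0).
Qed.

Lemma tvs_boundedP E :
  (forall U : set X, nbhs 0 U -> exists2 s : K, 0 < s &
     forall t, s <= `|t| -> forall x, E x -> U (t^-1 *: x)) -> tvs_bounded E.
Proof.
move=> H U /H[s s0 sE]; exists s => // t st x Ex.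
exists (t^-1 *: x); first exact: sE.
by rewrite scalerA mulfV ?scale1r// -normr_gt0 (lt_le_trans s0).
Qed.

Lemma tvs_boundedU E F : tvs_bounded E -> tvs_bounded F -> tvs_bounded (E `|` F).
Proof.
move=> bE bF U U0; have [s s0 sE] := bE U U0; have [r r0 rF] := bF U U0.
exists (s + r); first exact: addr_gt0.
move=> t srt x [Ex|Fx].
  by apply: sE => //; rewrite (le_trans _ srt)// lerDl ltW.
by apply: rF => //; rewrite (le_trans _ srt)// lerDr ltW.
Qed.

Lemma tvs_boundedZ (c : K) E : tvs_bounded E -> tvs_bounded ( *:%R c @` E).
Proof.
move=> bE; apply: tvs_boundedP => U U0.
have [->|c0] := eqVneq c 0.
  exists 1 => // t _ _ [x _ <-]; rewrite scale0r scaler0.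
  exact: nbhs_singleton.
have [s s0 sE] := tvs_bounded_eventually bE U0.
exists (s * `|c|); first by rewrite mulr_gt0// normr_gt0.
move=> t st _ [x Ex <-].
have -> : t^-1 *: (c *: x) = (t / c)^-1 *: x by rewrite invf_div scalerA mulrC.
by apply: sE => //; rewrite normrM normfV ler_pdivlMr// normr_gt0.
Qed.

Lemma tvs_bounded1 (x : X) : tvs_bounded [set x].
Proof.
apply: tvs_boundedP => U U0.
have := @scale_continuous K X (0, x) U; rewrite /= scale0r => /(_ U0).
move=> [[A B] [/= A0 Bx] AB].
have [e /= e0 eA] := A0.
exists (2 / e); first by rewrite divr_gt0.
move=> t et y ->; apply: (AB (t^-1, x)); split => /=; last exact: nbhs_singleton.
apply: eA => /=; rewrite sub0r normrN normfV.
have t0 : 0 < `|t| by rewrite (lt_le_trans _ et)// divr_gt0.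
rewrite invf_plt ?posrE//.
by rewrite (lt_le_trans _ et)// -[ltLHS]mul1r ltr_pM2r ?invr_gt0// ltr1n.
Qed.

End bounded_sets.

Section strong_dual.
Context (K : numFieldType) (Y : tvsType K).

Definition dual_pred : {pred Y -> K^o} :=
  fun f => `[< linear f /\ continuous f >].

Lemma dual_submod_closed : submod_closed dual_pred.
Proof.
split.
  apply/asboolP; split; last by move=> x; exact: cvg_cst.
  by move=> a u v; rewrite /= scaler0 addr0.
move=> a f g /asboolP[lf cf] /asboolP[lg cg]; apply/asboolP; split.
  move=> b u v; change (a *: f (b *: u + v) + g (b *: u + v) =
    b *: (a *: f u + g u) + (a *: f v + g v)).
  by rewrite lf lg !scalerDr addrACA !scalerA [a * b]mulrC.
move=> x; apply: (@cvgD K K^o Y); last exact: cg.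
by apply: (@cvgZl_tmp K K^o Y); exact: cf.
Qed.

HB.instance Definition _ := GRing.isSubmodClosed.Build K (Y -> K^o) dual_pred
  dual_submod_closed.

Record strong_dual := Dual {
  dual_fun :> Y -> K^o ;
  dual_funP : dual_fun \in dual_pred }.

HB.instance Definition _ := [isSub for dual_fun].
HB.instance Definition _ := [Choice of strong_dual by <:].
HB.instance Definition _ := [SubChoice_isSubLmodule of strong_dual by <:].


Lemma dual_linear (x : strong_dual) : linear x.
Proof. by case: x => f /= /asboolP[]. Qed.

Lemma dual_continuous (x : strong_dual) : continuous x.
Proof. by case: x => f /= /asboolP[]. Qed.

HB.instance Definition _ (x : strong_dual) :=
  GRing.isLinear.Build K Y K^o *:%R x (dual_linear x).

Lemma dual_addE (x y : strong_dual) u : (x + y) u = x u + y u.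
Proof. by []. Qed.

Lemma dual_oppE (x : strong_dual) u : (- x) u = - x u.
Proof. by []. Qed.

Lemma dual_scaleE a (x : strong_dual) u : (a *: x) u = a * x u.
Proof. by []. Qed.

Lemma dual_zeroE u : (0 : strong_dual) u = 0.
Proof. by []. Qed.

Lemma dual_ext (x y : strong_dual) : (forall u, x u = y u) -> x = y.
Proof. by move=> xy; apply: val_inj; apply/funext. Qed.

Definition polar (E : set Y) : set strong_dual :=
  [set x | forall u, E u -> `|x u| <= 1].

Lemma polar0 E : polar E 0.
Proof. by move=> u _; rewrite dual_zeroE normr0. Qed.

Definition strong_nbhs (x : strong_dual) : set_system strong_dual :=
  [set U | exists2 E : set Y, tvs_bounded E & [set y | polar E (y - x)] `<=` U].

HB.instance Definition _ := hasNbhs.Build strong_dual strong_nbhs.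


Let strong_nbhs_filter x : ProperFilter (strong_nbhs x).
Proof.
split; first by case=> E _ /(_ x); apply; rewrite /= subrr; exact: polar0.
split.
- by exists set0 => //; exact: tvs_bounded0.
- move=> U V [E bE EU] [F bF FV]; exists (E `|` F); first exact: tvs_boundedU.
  move=> y py; split; first by apply: EU => u Eu; apply: py; left.
  by apply: FV => u Fu; apply: py; right.
- by move=> U V UV [E bE EU]; exists E => //; exact: subset_trans UV.
Qed.

Let strong_nbhs_singleton x (U : set strong_dual) : strong_nbhs x U -> U x.
Proof. by case=> E _; apply; rewrite /= subrr; exact: polar0. Qed.

Lemma polar_half E (x y : strong_dual) :
  polar ( *:%R 2 @` E) x -> polar ( *:%R 2 @` E) y -> polar E (x + y).
Proof.
move=> px py u Eu.
have h (z : strong_dual) : polar ( *:%R 2 @` E) z -> `|z u| <= 2^-1.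
  move=> /(_ (2 *: u)); rewrite linearZ normrM ger0_norm// => pz.
  by rewrite -[leRHS]mul1r ler_pdivlMr// mulrC; apply: pz; exists u.
by rewrite dual_addE (le_trans (ler_normD _ _))// [leRHS]splitr !div1r lerD ?h.
Qed.

Let strong_nbhs_nbhs x (U : set strong_dual) :
  strong_nbhs x U -> strong_nbhs x (strong_nbhs^~ U).
Proof.
case=> E bE EU; exists ( *:%R 2 @` E); first exact: tvs_boundedZ.
move=> y yx; exists ( *:%R 2 @` E); first exact: tvs_boundedZ.
move=> z zy; apply: EU => /=.
by rewrite -(subrK y z) -addrA; exact: polar_half.
Qed.

HB.instance Definition _ := Nbhs_isNbhsTopological.Build strong_dual
  strong_nbhs_filter strong_nbhs_singleton strong_nbhs_nbhs.

Lemma strong_nbhsE (x : strong_dual) : nbhs x = strong_nbhs x.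
Proof. by []. Qed.

Let strong_add_continuous :
  continuous (fun z : strong_dual * strong_dual => z.1 + z.2).
Proof.
move=> [x y] U [E bE EU] /=.
have b2E := tvs_boundedZ 2 bE.
exists ([set z | polar ( *:%R 2 @` E) (z - x)],
        [set z | polar ( *:%R 2 @` E) (z - y)]) => /=.
  by split; exists ( *:%R 2 @` E).
move=> [z t] [/= zx ty]; apply: EU => /=.
by rewrite opprD addrACA; exact: polar_half.
Qed.

Lemma dual_bounded (x : strong_dual) (E : set Y) : tvs_bounded E ->
  exists2 M : K, 0 < M & forall u, E u -> `|x u| <= M.
Proof.
move=> bE.
have U0 : nbhs (0 : Y) [set u | `|x u| < 1].
  have /cvgrPdist_lt/(_ 1 ltr01) := @dual_continuous x 0.
  by apply: filterS => u /=; rewrite linear0 sub0r normrN.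
have [s s0 sE] := tvs_bounded_eventually bE U0.
exists s => // u Eu; have := sE s; rewrite (gtr0_norm s0) => /(_ (lexx _) u Eu).
rewrite /= linearZ normrM normfV (gtr0_norm s0) => h; apply: ltW.
by move: h; rewrite /= ltr_pdivrMl// mulr1.
Qed.

Let strong_scale_continuous :
  continuous (fun z : K^o * strong_dual => z.1 *: z.2).
Proof.
move=> [k x] U [E bE EU] /=.
have [M M0 xM] := dual_bounded x bE.
have M1 : 0 < 2 * (M + 1) by rewrite mulr_gt0// ltr_wpDr.
have k1 : 0 < `|k| + 1 by rewrite ltr_wpDl.
pose c := 2 * (`|k| + 1); have c0 : 0 < c by rewrite mulr_gt0.
exists (ball k (2 * (M + 1))^-1, [set z | polar ( *:%R c @` E) (z - x)]).
  split; last by exists ( *:%R c @` E) => //; exact: tvs_boundedZ.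
  by apply: nbhsx_ballx; rewrite invr_gt0.
move=> [l y] []; rewrite -ball_normE /= => kl yx; apply: EU => u Eu.
have lk : `|l| <= `|k| + 1.
  rewrite -[l](subrK k) [`|k| + 1]addrC (le_trans (ler_normD _ _))// lerD2r.
  rewrite distrC (le_trans (ltW kl))// invf_le1//.
  by rewrite mulrDr mulr1 (le_trans (ler1n _ 2))// lerDr mulr_ge0// ltW.
have -> : (l *: y - k *: x) u = l * (y - x) u + (l - k) * x u.
  by rewrite !(dual_addE, dual_oppE, dual_scaleE) mulrBr mulrBl addrA subrK.
rewrite (le_trans (ler_normD _ _))// !normrM [leRHS]splitr !div1r lerD//.
  have := yx (c *: u); rewrite linearZ normrM (gtr0_norm c0) => yxu.
  have {yxu} : c * `|(y - x) u| <= 1 by apply: yxu; exists u.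
  rewrite /c -mulrA -ler_pdivlMl// mulr1; apply: le_trans.
  by rewrite ler_wpM2r.
rewrite distrC (@le_trans _ _ ((2 * (M + 1))^-1 * M))//.
  by rewrite ler_pM ?xM// ltW.
rewrite invfM -mulrA ler_piMr// ler_pdivrMl ?ltr_wpDr// ?(ltW M0)//.
by rewrite mulr1 lerDl.
Qed.

(* The sets polar E are in general not open, hence this open convex variant. *)
Let open_polar (E : set Y) (x : strong_dual) : set strong_dual :=
  [set y | exists c : K, [/\ 0 <= c, c < 1 & forall u, E u -> `|(y - x) u| <= c]].

Let open_open_polar E x : tvs_bounded E -> open (open_polar E x).
Proof.
move=> bE; rewrite openE => y [c [c0 c1 yx]].
have d0 : 0 < (1 - c) / 2 by rewrite divr_gt0// subr_gt0.
pose d := ((1 - c) / 2)^-1; have dp : 0 < d by rewrite invr_gt0.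
exists ( *:%R d @` E); first exact: tvs_boundedZ.
move=> z zy; exists (c + (1 - c) / 2); split.
- by rewrite addr_ge0// ltW.
- rewrite -ltrBrDl ltr_pdivrMr// mulr_natr mulr2n ltrDl subr_gt0//.
move=> u Eu; rewrite -(subrK y z) -addrA dual_addE.
rewrite (le_trans (ler_normD _ _))// [leRHS]addrC lerD//; last exact: yx.
have := zy (d *: u); rewrite linearZ normrM (gtr0_norm dp) => zyu.
have {zyu} : d * `|(z - y) u| <= 1 by apply: zyu; exists u.
by rewrite /d ler_pdivrMl// mulr1.
Qed.

Local Open Scope convex_scope.

Let convex_open_polar E x : convex_set (open_polar E x).
Proof.
apply/convex_setW => y z; rewrite !inE => -[a [a0 a1 ya]] [b [b0 b1 zb]].
move=> t t0 t1; rewrite inE.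
exists (t%:num * a + (1 - t%:num) * b); split.
- by rewrite addr_ge0// mulr_ge0// ?subr_ge0 ltW.
- rewrite -[ltRHS](subrK t%:num 1) addrC.
  rewrite ltrD// ?gtr_pMr// ?subr_gt0//.
move=> u Eu.
have -> : ((y : convex_lmodType strong_dual) <| t |> z - x) u =
    t%:num * (y - x) u + (1 - t%:num) * (z - x) u.
  have -> : (y : convex_lmodType strong_dual) <| t |> z =
    t%:num *: y + (1 - t%:num) *: z by [].
  rewrite !(dual_addE, dual_oppE, dual_scaleE) !(mulrBr t%:num).
  rewrite [in RHS](mulrBr (1 - _)) addrACA; congr (_ + _).
  by rewrite -opprD -mulrDl [t%:num + _]addrC subrK mul1r.
rewrite (le_trans (ler_normD _ _))// !normrM (gtr0_norm t0).
have t1' : 0 < 1 - t%:num by rewrite subr_gt0.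
rewrite (gtr0_norm t1') lerD//.
  by apply: ler_wpM2l; [exact: ltW|exact: ya].
by apply: ler_wpM2l; [exact: ltW|exact: zb].
Qed.

Let strong_locally_convex : exists2 B : set_system strong_dual,
  (forall b, b \in B -> convex_set b) & basis B.
Proof.
exists [set b | exists E x, tvs_bounded E /\ b = open_polar E x].
  by move=> b; rewrite inE => -[E [x [_ ->]]]; exact: convex_open_polar.
split; first by move=> b [E [x [bE ->]]]; exact: open_open_polar.
move=> x U [E bE EU]; exists (open_polar E x); last first.
  by move=> y [c [c0 c1 yx]]; apply: EU => u Eu; rewrite (le_trans (yx u Eu))// ltW.
split; first by exists E, x.
by exists 0; split=> // u _; rewrite subrr dual_zeroE normr0.
Qed.

HB.instance Definition _ := PreTopologicalLmod_isTvs.Build K strong_dual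
  strong_add_continuous strong_scale_continuous strong_locally_convex.
HB.instance Definition _ :=
  PreTopologicalNmodule_isTopologicalNmodule.Build strong_dual
    strong_add_continuous.
HB.instance Definition _ :=
  TopologicalNmodule_isTopologicalLmodule.Build K strong_dual
    strong_scale_continuous.
HB.instance Definition _ :=
  Uniform_isTvs.Build K strong_dual strong_locally_convex.

Lemma nbhs0_strong_dual (U : set strong_dual) :
  nbhs 0 U <-> exists2 E : set Y, tvs_bounded E & polar E `<=` U.
Proof.
split=> -[E bE EU]; exists E => //; move=> y yE; apply: EU => /=.
  by rewrite subr0.
by rewrite /= subr0 in yE.
Qed.

End strong_dual.

Section reflexivity.
Context (K : numFieldType) (X : tvsType K).

Lemma eval_in_dual (x : X) :
  (fun f : strong_dual X => f x) \in @dual_pred K (strong_dual X).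
Proof.
apply/asboolP; split; first by [].
move=> f; apply/(@cvgrPdist_le K K^o _ (nbhs f)) => e e0.
exists [set e^-1 *: x]; first exact: tvs_bounded1.
move=> g /(_ _ erefl); rewrite linearZ normrM gtr0_norm ?invr_gt0//.
rewrite ler_pdivrMl// mulr1 distrC; exact.
Qed.

Definition bidual_inclusion (x : X) : strong_dual (strong_dual X) :=
  Dual (eval_in_dual x).

Lemma bidual_inclusion_linear : linear bidual_inclusion.
Proof. by move=> a x y; apply: dual_ext => f; rewrite /= linearP. Qed.

HB.instance Definition _ :=
  GRing.isLinear.Build K X (strong_dual (strong_dual X)) *:%R
    bidual_inclusion bidual_inclusion_linear.

Definition reflexive_tvs :=
  exists g : strong_dual (strong_dual X) -> X,
    [/\ cancel bidual_inclusion g, cancel g bidual_inclusion,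
        continuous bidual_inclusion & continuous g].

End reflexivity.

Definition quasi_linfty_barrelled (K : numFieldType) (Y : tvsType K) :=
  forall x : nat -> strong_dual Y, tvs_bounded (range x) ->
    equicontinuous [set: nat] (fun n => x n : Y -> K^o).

(* sigma(Y',Y) and sigma(X,X') as initial topologies for the evaluation maps. *)
Definition weak_star_topology (K : numFieldType) (Y : tvsType K) :=
  initial_topology (fun x : strong_dual Y => dual_fun x : {ptws Y -> K^o}).

Definition sigma_topology (K : numFieldType) (X : tvsType K) :=
  initial_topology
    (fun x : X => (fun f => f x) : {ptws strong_dual X -> K^o}).

Section dynamics.
Context (R : realType).

(* The supremum over m is a maximum: the counts are integers at most N. The
   term N = 0 does not affect the limsup. *)
Definition upper_banach_density (A : set nat) : \bar R :=
  limn_esup (fun N => ereal_sup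
    [set ((\sum_(m.+1 <= n < (m + N).+1) (n \in A))%:R / N%:R : R)%:E
      | m in [set: nat]]).

Context (K : numFieldType) (X : tvsType K) (T : X -> X).

Definition return_times (x : X) (E : set X) : set nat :=
  [set n | (0 < n)%N /\ E (iter n T x)].

Definition RRec : set X :=
  [set x | forall U, nbhs x U -> (0 < upper_banach_density (return_times x U))%E].

Definition positive_orbit (x : X) : set X := [set iter n T x | n in [set n | (0 < n)%N]].

Definition lbo : set X :=
  [set x | exists2 U, nbhs x U & tvs_bounded (U `&` positive_orbit x)].

End dynamics.

(* g_sigma_algebraType carries its sigma-algebra only over a pointedType,
   which a tvsType is not. *)
Definition pointed_tvs (K : numFieldType) (X : tvsType K) : Type := X.

HB.instance Definition _ (K : numFieldType) (X : tvsType K) :=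
  Choice.on (pointed_tvs X).
HB.instance Definition _ (K : numFieldType) (X : tvsType K) :=
  isPointed.Build (pointed_tvs X) (0 : X).

Notation borel X := (@g_sigma_algebraType (pointed_tvs X) (@open X)).

Section measures.
Context (R : realType) (K : numFieldType) (X : tvsType K).
Variable mu : probability (borel X) R.

Definition invariant_measure (T : X -> X) :=
  forall A : set (borel X), measurable A -> mu A = mu (T @^-1` A).

Definition measure_support : set X :=
  ~` \bigcup_(U in [set U : set X | open U /\ mu U = 0%E]) U.

Definition full_support :=
  forall U : set X, open U -> U !=set0 -> (0 < mu U)%E.

(* Equality of measures is equality on measurable sets. *)
Definition nontrivial_measure :=
  ~ forall A : set (borel X), measurable A -> mu A = @dirac _ (borel X) (0 : X) R A.

End measures.

(* Main.v *)
(* For a recurrent vector x0 and a neighbourhood W of x0 that is a translated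
   polar, the return times N0 of x0 to W have positive upper Banach density, so
   some shift-invariant mean m on N satisfies m(N0) > 0. Seen on the clopen
   sets of the space of ultrafilters on N (the Stone-Cech compactification of
   N), m is a content, countably additive by compactness, and it extends to a
   shift-invariant measure nu. Since the orbit is bounded along every translate
   N0 + j, it has a weak-star limit pi(p) along every ultrafilter p containing
   some N0 + j. The set G of these ultrafilters is mapped into itself by the
   shift, nu(G) >= m(N0) > 0, and pi o shift = T o pi on G because T is an
   adjoint; hence the normalised image under pi of nu restricted to G is
   T-invariant, charges W, and lives on the weak-star closure of the orbit.
   Countable mixtures of such measures give both conclusions. The two cases
   (strong duals and reflexive spaces) only use an abstract pairing e : Y -> X
   -> K for which polars form a basis at 0 and bounded sequences have pointwise
   limits along ultrafilters. *)
From HB Require Import structures.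
Require Import Defs.
From mathcomp Require Import all_boot all_order all_algebra.
From mathcomp Require Import complex.
From mathcomp Require Import all_classical all_reals all_analysis.

Set Implicit Arguments.
Unset Strict Implicit.
Unset Printing Implicit Defensive.

Import Order.TTheory GRing.Theory Num.Theory.
Import numFieldTopology.Exports numFieldNormedType.Exports.

Local Open Scope classical_set_scope.
Local Open Scope ring_scope.

(** * Invariant means *)

Lemma ultra_fmap (T U : Type) (f : T -> U) (F : set_system T) :
  UltraFilter F -> UltraFilter (f @ F).
Proof.
move=> FU; split; first exact: fmap_proper_filter.
move=> G GF sFG; rewrite predeqE => A; split; last exact: sFG.
move=> GA; have [//|FnA] := in_ultra_setVsetC (f @^-1` A) FU.
have /filter_ex[x []//] : G (A `&` ~` A) by apply: filterI => //; exact: sFG.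
Qed.

Lemma ultra_cvg_itv (R : realType) (T : Type) (F : set_system T)
    (f : T -> R) (a b : R) : UltraFilter F ->
  F [set t | a <= f t <= b] -> cvg (f @ F).
Proof.
move=> FU fab; have := @segment_compact R a b; rewrite compact_ultra => cab.
have [|l [_ Fl]] := cab (f @ F) (ultra_fmap f FU).
  by apply: filterS fab => t /= fab; rewrite in_itv/=; exact: fab.
by apply/cvg_ex; exists l.
Qed.

Section invariant_mean.
Context (R : realType).

Definition count_in (A : set nat) (m N : nat) : nat :=
  \sum_(m.+1 <= n < (m + N).+1) (n \in A).

Lemma count_in_le A m N : (count_in A m N <= N)%N.
Proof.
rewrite /count_in (@leq_trans (\sum_(m.+1 <= n < (m + N).+1) 1))//.
  by apply: leq_sum => i _; case: (_ \in _).
by rewrite sum_nat_const_nat muln1 subSS addKn.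
Qed.

Lemma count_inT m N : count_in setT m N = N.
Proof.
rewrite /count_in (eq_bigr (fun=> 1%N)) => [|i _]; last by rewrite in_setT.
by rewrite sum_nat_const_nat muln1 subSS addKn.
Qed.

Lemma count_inU A B m N : A `&` B = set0 ->
  count_in (A `|` B) m N = (count_in A m N + count_in B m N)%N.
Proof.
move=> AB0; rewrite /count_in -big_split/=; apply: eq_bigr => i _.
rewrite in_setU; have [iA|] := boolP (i \in A); have [iB|] := boolP (i \in B) => //.
by have : set0 i by rewrite -AB0; split; exact: set_mem.
Qed.

(** Moving the window by one affects only its two end terms. The identity is written with sums on
    both sides to avoid truncated subtraction. *)
Lemma count_in_shift (A : set nat) m N :
  (count_in [set n | A n.+1] m N + (m.+1 \in A) =
   count_in A m N + ((m + N).+1 \in A))%N.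
Proof.
rewrite /count_in.
have -> : (\sum_(m.+1 <= n < (m + N).+1) (n \in [set n | A n.+1]) =
           \sum_(m.+2 <= n < (m + N).+2) (n \in A))%N.
  rewrite -[m.+2]addn1 -[(m + N).+2]addn1 [RHS]big_addn addnK.
  by apply: eq_bigr => i _; rewrite addn1; congr (nat_of_bool _);
    apply/idP/idP => /set_mem/=; exact: mem_set.
rewrite addnC -(@big_ltn _ _ addn).
  by rewrite big_nat_recr//= ltnS leq_addr.
by rewrite !ltnS leq_addr.
Qed.

Lemma upper_banach_density_gt0 A : (0 < upper_banach_density R A)%E ->
  exists2 c : R, 0 < c & forall k, exists N m,
    (k < N)%N /\ c <= (count_in A m N)%:R / N%:R.
Proof.
rewrite /upper_banach_density limn_esup_lim; set u := (X in esups X) => u0.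
(* Half of the density serves as [c] when the density is finite, and 1 otherwise. *)
have [c /= c0 cu] : exists2 c : R, 0 < c & (c%:E < limn (esups u))%E.
  move: u0; case: (limn _) => [r|_|//].
  - rewrite lte_fin => r0; exists (r / 2); first by rewrite divr_gt0.
    by rewrite lte_fin ltr_pdivrMr// ltr_pMr// ltr1n.
  - by exists 1 => //; exact: ltry.
exists c => // k.
(* The upper limit is the infimum of the tail suprema; the tail from [k.+1] yields a window of
   length greater than [k]. *)
have /(lt_le_trans cu) : (limn (esups u) <= esups u k.+1)%E.
  rewrite (cvg_lim _ (@cvg_esups_inf _ u))//; apply: ereal_inf_lbound.
  by exists k.+1.
move=> /ereal_sup_gt[_ [N /= kN <-]] /ereal_sup_gt[_ [m _ <-]].
by rewrite lte_fin => cm; exists N, m; split => //; exact: ltW.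
Qed.

(** [m B] is the limit, along a free ultrafilter, of the frequency of [B] in windows of growing
    length where [A] has frequency at least [c]. *)
Lemma invariant_mean A : (0 < upper_banach_density R A)%E ->
  exists m : set nat -> R,
    [/\ forall B, 0 <= m B, m setT = 1,
        forall B C, B `&` C = set0 -> m (B `|` C) = m B + m C,
        forall B : set nat, m [set n | B n.+1] = m B & 0 < m A].
Proof.
move=> /upper_banach_density_gt0[c c0 /choice[N /choice[p Np]]].
pose d B k : R := (count_in B (p k) (N k))%:R / (N k)%:R.
have N0 k : (0 : R) < (N k)%:R.
  by rewrite ltr0n (leq_ltn_trans (leq0n k))//; exact: (Np k).1.
have dab B k : 0 <= d B k <= 1.
  rewrite /d divr_ge0//= ler_pdivrMr// mul1r ler_nat; exact: count_in_le.
have [F [FU sF]] := ultraFilterLemma (eventually_filter).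
have cF B : cvg (d B @ F).
  apply: (@ultra_cvg_itv _ _ _ _ 0 1); apply: filterS filterT => k _; exact: dab.
exists (fun B => lim (d B @ F)); split.
- by move=> B; apply: limr_ge => //; apply: nearW => k; case/andP: (dab B k).
- apply/cvg_lim => //; rewrite (_ : d setT = cst 1); first exact: cvg_cst.
  by apply/funext => k; rewrite /d count_inT divff// gt_eqF.
- move=> B C BC; apply/cvg_lim => //.
  rewrite (_ : d _ = d B \+ d C); first exact: cvgD.
  by apply/funext => k; rewrite /d count_inU// natrD mulrDl.
- move=> B; apply/cvg_lim => //.
  rewrite (_ : d _ = d B + (d [set n | B n.+1] - d B)); last first.
    by rewrite addrC subrK.
  rewrite -[X in _ --> X]addr0; apply: cvgD => //.
  apply: (@cvg_trans _ ((d [set n | B n.+1] - d B) @ \oo)).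
    exact: (@cvg_app _ _ _ _ (d [set n | B n.+1] - d B) sF).
  apply/cvgr0Pnorm_le => e e0; near=> k.
  have Bk := congr1 (fun n => n%:R : R) (count_in_shift B (p k) (N k)).
  rewrite !natrD in Bk.
  have -> : (d [set n | B n.+1] - d B) k =
      (((p k + N k).+1 \in B)%:R - ((p k).+1 \in B)%:R) / (N k)%:R.
    rewrite /d !fctE -mulrBl; congr (_ / _); apply/eqP.
    by rewrite subr_eq addrAC eq_sym subr_eq addrC -Bk addrC.
  (* The end terms differ by at most 1 and the window is longer than [k], so the error caused by the
     shift vanishes in the limit. *)
  rewrite normrM normfV (gtr0_norm (N0 k)) ler_pdivrMr//.
  apply: (@le_trans _ _ 1).
    by case: (_ \in B); case: (_ \in B); rewrite ?subrr ?normr0 ?subr0 ?sub0r ?normrN ?normr1.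
  rewrite -ler_pdivrMl// mulr1 (@le_trans _ _ k%:R)//; last first.
    by rewrite ler_nat; exact: ltnW (Np k).1.
  by near: k; exact: nbhs_infty_ger.
- apply: (lt_le_trans c0); apply: limr_ge => //; apply: nearW => k.
  exact: (Np k).2.
Unshelve. all: by end_near. Qed.

End invariant_mean.

(** * The space of ultrafilters *)

Record ultra := Ultra { ultra_sets :> set_system nat ; ultraP : UltraFilter ultra_sets }.

#[global] Existing Instance ultraP.

Definition ultra_principal (n : nat) : ultra := Ultra (principal_filter_ultra n).

HB.instance Definition _ := gen_eqMixin ultra.
HB.instance Definition _ := gen_choiceMixin ultra.
HB.instance Definition _ := isPointed.Build ultra (ultra_principal 0).

Section ultrafilter_space.
Implicit Types (A B : set nat) (C : set ultra).

Definition stone A : set ultra := [set p | ultra_sets p A].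

Lemma stone0 : stone set0 = set0.
Proof. by rewrite predeqE => p; split=> // /filter_ex[]. Qed.

Lemma stoneT : stone setT = setT.
Proof. by rewrite predeqE => p; split=> // _; exact: filterT. Qed.

Lemma stoneC A : stone (~` A) = ~` stone A.
Proof.
rewrite predeqE => p; split=> [nA /= pA|].
  by have /filter_ex[x []] : ultra_sets p (A `&` ~` A) by exact: filterI.
by have [//|] := in_ultra_setVsetC A (ultraP p).
Qed.

Lemma stoneI A B : stone (A `&` B) = stone A `&` stone B.
Proof.
rewrite predeqE => p; split=> [pAB|[]]; last exact: filterI.
by split; apply: filterS pAB => x [].
Qed.

Lemma stoneU A B : stone (A `|` B) = stone A `|` stone B.
Proof. by rewrite -[LHS]setCK -stoneC setCU stoneI !stoneC setCI !setCK. Qed.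

Lemma stone_principal A n : stone A (ultra_principal n) <-> A n.
Proof. exact: principal_filterP. Qed.

Lemma stone_subset A B : stone A `<=` stone B <-> A `<=` B.
Proof.
split=> [AB n An|AB p]; last exact: filterS.
exact/stone_principal/AB/stone_principal.
Qed.

(** If no finite subfamily covers [A], the sets [A] minus finite unions form a filter base. An
    ultrafilter refining it lies in [stone A] but in no [stone (F i)]. *)
Lemma stone_compact A (F : nat -> set nat) :
  stone A `<=` \bigcup_i stone (F i) -> exists n, A `<=` \bigcup_(i < n) F i.
Proof.
move=> AF; apply: contrapT => /forallNP nAF.
pose G := filter_from [set: nat] (fun n => A `\` \bigcup_(i < n) F i).
have PG : ProperFilter G.
  apply: filter_from_proper => [|n _]; last first.
    have /nonsubset[x [Ax nFx]] := nAF n.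
    by exists x.
  apply: filter_from_filter; first by exists 0.
  move=> i j _ _; exists (maxn i j) => // x [Ax nFx].
  by split; split=> //; apply: contra_not nFx => -[k /= ki Fk]; exists k => //=;
    rewrite (leq_trans ki)// ?leq_maxl ?leq_maxr.
have [U [UU GU]] := ultraFilterLemma PG.
have [|i _ /= UFi] := AF (Ultra UU).
  by apply: GU; exists 0 => // x [].
have /filter_ex[x [[_ nFx] Fx]] :
    U ((A `\` \bigcup_(k < i.+1) F k) `&` F i).
  by apply: filterI => //; apply: GU; exists i.+1.
by apply: nFx; exists i => /=.
Qed.

Definition ultra_shift (p : ultra) : ultra := Ultra (ultra_fmap S (ultraP p)).

Lemma stone_shift A : ultra_shift @^-1` stone A = stone [set n | A n.+1].
Proof. by []. Qed.

Let range0 : range stone set0.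
Proof. by exists set0 => //; exact: stone0. Qed.

Let rangeU : setU_closed (range stone).
Proof.
by move=> _ _ [A _ <-] [B _ <-]; exists (A `|` B) => //; exact: stoneU.
Qed.

Let rangeC : setC_closed (range stone).
Proof. by move=> _ [A _ <-]; exists (~` A) => //; exact: stoneC. Qed.

HB.instance Definition _ := isAlgebraOfSets.Build default_measure_display ultra
  range0 rangeU rangeC.

Lemma stone_measurable A : measurable (stone A).
Proof. by exists A. Qed.

End ultrafilter_space.

(** On [ultra] itself, [measurable] means being some [stone A], which gives an algebra only;
    measures live on the sigma-algebra it generates. *)
Notation ultra_salgebra := (g_sigma_algebraType (@measurable _ ultra)).

(** * From finitely additive means to shift-invariant measures *)

Section mean_measure.
Context (R : realType) (m : set nat -> R).
Hypothesis m_ge0 : forall B, 0 <= m B.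
Hypothesis mU : forall B C, B `&` C = set0 -> m (B `|` C) = m B + m C.

Let m0 : m set0 = 0.
Proof.
by have := mU (setI0 set0); rewrite setU0 => /eqP; rewrite -subr_eq subrr => /eqP.
Qed.

(* A is recovered from [stone A] as the trace on principal ultrafilters. *)
Let premeasure (C : set ultra) : \bar R := (m [set n | C (ultra_principal n)])%:E.

Let premeasureE A : premeasure (stone A) = (m A)%:E.
Proof.
congr (m _)%:E; rewrite predeqE => n; exact: stone_principal.
Qed.

Let premeasure0 : premeasure set0 = 0%E.
Proof. by rewrite -stone0 premeasureE m0. Qed.

Let premeasure_ge0 C : (0 <= premeasure C)%E.
Proof. by rewrite lee_fin. Qed.

Let m_sum (B : nat -> set nat) n : trivIset setT B ->
  m (\big[setU/set0]_(i < n) B i) = \sum_(i < n) m (B i).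
Proof.
move=> tB; elim: n => [|n IHn]; first by rewrite !big_ord0.
rewrite !big_ord_recr/= -IHn; apply: mU.
by rewrite (@trivIset_bigsetUI _ predT)// => i j _ _; exact: tB.
Qed.

(** By compactness, a disjoint sequence of sets [stone (B k)] whose union is again some [stone A]
    has only finitely many non-empty terms, so finite additivity suffices. *)
Let premeasure_sigma_additive : semi_sigma_additive premeasure.
Proof.
move=> F /(_ _)/cid2-/all_sig2[B _ BF] tF [A _ AF].
have {BF}FB : F = stone \o B by apply/funext => n; rewrite -BF.
have tB : trivIset setT B.
  apply/trivIsetP => i j _ _ ij.
  have /trivIsetP/(_ i j I I ij) := tF.
  rewrite FB /= -stoneI -stone0 => h.
  by rewrite -subset0; apply/stone_subset; rewrite h.
have [|n An] := @stone_compact A B; first by rewrite AF FB.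
have BA k : B k `<=` A.
  apply/stone_subset; rewrite AF => p pk; exists k => //; by rewrite FB.
have B0 k : (n <= k)%N -> B k = set0.
  move=> nk; rewrite -subset0 => x Bx.
  have [i /= ni Bi] := An _ (BA _ _ Bx).
  have ik : i != k by rewrite neq_ltn (leq_trans ni).
  by have /trivIsetP/(_ i k I I ik) := tB; rewrite -subset0; apply; split; eassumption.
have Asum : A = \big[setU/set0]_(i < n) B i.
  rewrite -bigcup_mkord; apply/seteqP; split=> // x [i _]; exact: BA.
rewrite -AF premeasureE; apply: cvg_near_cst; near=> k.
have nk : (n <= k)%N by near: k; exact: nbhs_infty_ge.
rewrite Asum m_sum// FB.
rewrite (eq_bigr (fun i => (m (B i))%:E)) => [|i _]; last exact: premeasureE.
rewrite (big_cat_nat _ nk)//= [X in (_ + X)%E]big_nat.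
rewrite [X in (_ + X)%E]big1 ?adde0 ?sumEFin ?big_mkord// => i /andP[ni _].
by rewrite B0 ?m0.
Unshelve. all: by end_near. Qed.

HB.instance Definition _ := isMeasure.Build _ _ _ premeasure
  premeasure0 premeasure_ge0 premeasure_sigma_additive.

Lemma mean_measure : exists nu : {measure set ultra_salgebra -> \bar R},
  forall A, nu (stone A) = (m A)%:E.
Proof.
exists (measure_extension premeasure) => A.
rewrite -premeasureE; apply: (@measurable_mu_extE _ _ _ premeasure).
by exists A.
Qed.

End mean_measure.

Section shift_invariance.
Context (R : realType) (nu : {measure set ultra_salgebra -> \bar R}).
Hypothesis nu_fin : (nu setT < +oo)%E.
Hypothesis nu_shift : forall A : set nat, nu (stone [set n | A n.+1]) = nu (stone A).

Lemma measurable_ultra_shift :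
  measurable_fun setT (ultra_shift : ultra_salgebra -> ultra_salgebra).
Proof.
apply: (@measurability _ _ ultra_salgebra ultra_salgebra setT ultra_shift
  (range stone)) => //.
move=> _ [_ [A _ <-] <-]; rewrite setTI stone_shift.
by apply: sub_sigma_algebra; exists [set n | A n.+1].
Qed.

(** The sets [stone A] are stable under intersection and generate the sigma-algebra, so [nu] and its
    image under the shift, which agree on them, coincide. *)
Lemma shift_invariant (C : set ultra_salgebra) : measurable C ->
  nu (ultra_shift @^-1` C) = nu C.
Proof.
move=> mC; apply/esym.
apply: (@measure_unique _ _ ultra_salgebra (range stone) (fun=> setT) _ _ _ _ nu
  [the measure _ _ of pushforward nu
    (ultra_shift : ultra_salgebra -> ultra_salgebra)]) => //.
- by move=> _ _ [A _ <-] [B _ <-]; exists (A `&` B) => //; exact: stoneI.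
- by move=> _; exists setT => //; exact: stoneT.
- by rewrite bigcup_const.
- exact: measurable_ultra_shift.
- by move=> ? _ [A _ <-]; rewrite -nu_shift.
Qed.

End shift_invariance.

(** * Second countability and measures *)

Section second_countability.
Context (R : realType) (X : topologicalType).

Definition base_seq (B : nat -> set X) :=
  (forall n, open (B n)) /\
  forall x U, nbhs x U -> exists n, B n x /\ B n `<=` U.

Lemma separable_metrizable_base : separable_space X ->
  completely_metrizable R X -> exists B, base_seq B.
Proof.
move=> [D /countable_injP[f finj] dD] [d [d0 dC dT dnbhs _]].
have dball x (r : R) : open [set y | d x y < r].
  rewrite openE => y /= xy; apply/dnbhs.
  exists (r - d x y) => [|z /= yz]; first by rewrite subr_gt0.
  by rewrite (le_lt_trans (dT _ y _))// addrC -ltrBrDr.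
(* [n] codes a pair [(i, k)]: the ball of radius [1 / (k + 1)] about the point of [D] numbered [i],
   empty if there is none. *)
pose B n := if unpickle n is Some (i, k) then
  [set y | exists x, [/\ D x, f x = i & d x y < k.+1%:R^-1]] else set0.
exists B; split=> [n|x U /dnbhs[e e0 xU]].
  rewrite /B; case: unpickle => [[i k]|]; last exact: open0.
  rewrite openE => y [x [Dx fx xy]].
  apply: filterS (open_nbhs_nbhs (conj (dball x k.+1%:R^-1) xy)) => z xz.
  by exists x.
have e20 : 0 < e / 2 by rewrite divr_gt0.
have [k _ /(_ _ (leqnn k)) ke] := near_infty_natSinv_lt (PosNum e20).
have dxx : d x x = 0 by exact/d0.
have [|y [xy Dy]] := dD [set y | d x y < k.+1%:R^-1] _ (dball _ _).
  by exists x; rewrite /= dxx invr_gt0.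
exists (pickle (f y, k)); rewrite /B pickleK; split.
  by exists y; rewrite dC.
move=> z [y' [Dy' ff y'z]]; apply: xU => /=.
have yz : d y z < k.+1%:R^-1 by rewrite -(finj y' y)// ?inE.
rewrite (le_lt_trans (dT _ y _))// (splitr e) ltrD//.
  exact: lt_trans xy ke.
exact: lt_trans yz ke.
Qed.

(** For each basic set contained in some [V i], one such [i] is chosen; [None] marks the basic sets
    contained in no [V i]. *)
Lemma base_seq_lindelof (B : nat -> set X) (I : Type) (V : I -> set X) :
  base_seq B -> (forall i, open (V i)) ->
  exists J : nat -> option I,
    forall i x, V i x -> exists n j, J n = Some j /\ V j x.
Proof.
move=> [_ baseB] oV.
have /choice[J JP] : forall n, exists oi : option I,
    (exists i, B n `<=` V i) -> exists2 i, oi = Some i & B n `<=` V i.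
  move=> n; have [[i Bi]|nB] := pselect (exists i, B n `<=` V i).
    by exists (Some i) => _; exists i.
  by exists None => /nB.
exists J => i x Vix; have [n [Bx BV]] := baseB x _ (open_nbhs_nbhs (conj (oV i) Vix)).
have [j Jn Bj] := JP n (ex_intro _ i BV).
by exists n, j; split => //; exact: Bj.
Qed.

Lemma completely_metrizable_T1 (x y : X) : completely_metrizable R X ->
  x <> y -> exists2 U, nbhs x U & ~ U y.
Proof.
move=> [d [d0 dC dT dnbhs _]] xy; exists [set z | d x z < d x y]; last first.
  by rewrite /= ltxx.
apply/dnbhs; exists (d x y) => //; rewrite lt_neqAle; apply/andP; split.
  by apply/eqP => /esym/d0.
(* Nonnegativity of [d] follows from [0 = d x x <= 2 * d x y]. *)
have := dT x y x; rewrite (dC y x) (d0 x x).2// => h.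
by rewrite -(@pmulrn_lge0 _ _ 2)// mulr2n.
Qed.

End second_countability.

(** * Images and mixtures of measures *)

Section restricted_image.
Context d d' (T1 : measurableType d) (T2 : measurableType d') (R : realType).
Variables (nu : {measure set T1 -> \bar R}) (G : set T1) (f : T1 -> T2).
Hypotheses (mG : measurable G) (mf : measurable_fun G f).

(** Restriction and image are taken in one step because [f] is only assumed measurable on [G]. *)
Let restr_image A := nu (G `&` f @^-1` A).

Let restr_image0 : restr_image set0 = 0%E.
Proof. by rewrite /restr_image preimage_set0 setI0 measure0. Qed.

Let restr_image_ge0 A : (0 <= restr_image A)%E.
Proof. exact: measure_ge0. Qed.

Let restr_image_sigma_additive : semi_sigma_additive restr_image.
Proof.
move=> F mF tF mUF; rewrite /restr_image preimage_bigcup setI_bigcupr.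
apply: measure_semi_sigma_additive.
- by move=> n; exact: mf.
- apply/trivIsetP => /= i j _ _ ij; rewrite setIACA -preimage_setI.
  by move/trivIsetP : tF => /(_ _ _ _ _ ij) ->//; rewrite preimage_set0 setI0.
- by rewrite -setI_bigcupr -preimage_bigcup; exact: mf.
Qed.

HB.instance Definition _ := isMeasure.Build _ _ _ restr_image
  restr_image0 restr_image_ge0 restr_image_sigma_additive.

Lemma restricted_image_probability : (0 < nu G)%E -> (nu G < +oo)%E ->
  exists mu : probability T2 R, forall A,
    mu A = (nu (G `&` f @^-1` A) * (fine (nu G))^-1%:E)%E.
Proof.
(* [dirac point] is the default of the normalisation for mass zero or infinity, both excluded
   here. *)
move=> G0 Goo; exists (mnormalize restr_image (dirac point)) => A.
have imT : [the measure _ _ of restr_image] setT = nu G by rewrite /= /restr_image setIT.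
by rewrite /= /mnormalize imT (gt_eqF G0) (lt_eqF Goo).
Qed.

End restricted_image.

Section convex_series.
Context d (T : measurableType d) (R : realType) (mu : nat -> probability T R).

Let w (k : nat) : {nonneg R} := ((2 ^ (k + 1))%:R^-1)%:nng.

Local Open Scope ereal_scope.

Let combination := mseries (fun k => mscale (w k) (mu k)) 0.

HB.instance Definition _ := Measure.on combination.

Let combinationT : combination setT = 1.
Proof.
rewrite -[RHS]/(1%:E) -[in RHS](divr1 1) -[in RHS](expr0 2%:R).
rewrite -(cvg_lim _ (@cvg_geometric_eseries_half R 1 0))//.
apply: eq_eseriesr => k _; rewrite div1r.
exact: etrans (congr1 (mule _) (probability_setT (mu k))) (mule1 _).
Qed.

HB.instance Definition _ :=
  Measure_isProbability.Build _ _ _ combination combinationT.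

(** The weights are [2 ^ -(k + 1)]. The three clauses transfer, in order, invariance (with [B] the
    preimage of [A]), null sets and positivity. *)
Lemma countable_mixture : exists P : probability T R,
  [/\ forall A B, (forall i, mu i A = mu i B) -> P A = P B,
      forall A, (forall i, mu i A = 0) -> P A = 0 &
      forall i A, measurable A -> 0 < mu i A -> 0 < P A].
Proof.
exists combination; split.
- move=> A B AB; apply: eq_eseriesr => k _.
  by rewrite /mscale; exact: (congr1 (mule (w k)%:num%:E) (AB k)).
- move=> A A0; apply: eseries0 => k _ _.
  by rewrite /mscale; exact: etrans (congr1 (mule (w k)%:num%:E) (A0 k)) (mule0 _).
- move=> i A mA Ai.
  apply: (@lt_le_trans _ _ (mscale (w i) (mu i) A)).
    by rewrite /mscale mule_gt0// lte_fin/= invr_gt0 ltr0n expn_gt0.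
  rewrite /combination /mseries /=.
  apply: le_trans (nneseries_lim_ge i.+1 _) => [|k _ _]; last exact: measure_ge0.
  by rewrite big_nat_recr//= leeDr// sume_ge0.
Qed.

End convex_series.

(** * Limits of orbits along ultrafilters *)

Section weak_pairing.
Context (R : realType) (K : numFieldType) (X : tvsType K) (Y : topologicalType).
Variable e : Y -> X -> K^o.

Definition pairing_polar (E : set Y) : set X :=
  [set x | forall u, E u -> `|e u x| <= 1].

Definition weak_topology_of := initial_topology (fun x : X => e^~ x : {ptws Y -> K^o}).

Hypothesis K_arch : forall r : K, 0 < r -> exists k : nat, k.+1%:R^-1 < r.
Hypothesis eB : forall u x y, e u (x - y) = e u x - e u y.
Hypothesis e_cont : forall u, continuous (e u).
Hypothesis e_nbhs : forall W, nbhs (0 : X) W ->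
  exists E, nbhs 0 (pairing_polar E) /\ pairing_polar E `<=` W.
Hypothesis X_met : completely_metrizable R X.

Lemma nbhs_sub (x : X) (V : set X) : nbhs 0 V -> nbhs x [set y | V (y - x)].
Proof.
move=> /(nbhsT x); apply: filterS => _ [z Vz <-] /=.
by rewrite addrC addKr.
Qed.

Lemma nbhs_add (x : X) (U : set X) : nbhs x U -> nbhs 0 [set z | U (z + x)].
Proof.
move=> /(nbhsB (- x)); rewrite addNr; apply: filterS => _ [z Uz <-] /=.
by rewrite addrC addrA subrr add0r.
Qed.

Lemma polar_nbhs (x : X) (U : set X) : nbhs x U ->
  exists E, nbhs x [set y | pairing_polar E (y - x)] /\
    [set y | pairing_polar E (y - x)] `<=` U.
Proof.
move=> /nbhs_add/e_nbhs[E [E0 EU]]; exists E; split; first exact: nbhs_sub.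
by move=> y /EU /=; rewrite subrK.
Qed.

(** If all pairings agree, [y - x] lies in every polar, hence [y] lies in every neighbourhood of
    [x]. *)
Lemma pairing_separates (x y : X) : (forall u, e u x = e u y) -> x = y.
Proof.
move=> exy; apply: contrapT => /(completely_metrizable_T1 X_met)[U /polar_nbhs].
move=> [E [_ EU]]; apply; apply: EU => u _.
by rewrite eB exy subrr normr0.
Qed.

Lemma weak_cvg (F : set_system X) (l : X) : Filter F ->
  (forall u, e u @ F --> e u l) -> F --> (l : weak_topology_of).
Proof.
move=> FF eF A [_ [[B oB <-] /= Bl BA]].
pose g (x : X) : {ptws Y -> K^o} := e^~ x.
have gF : {ptws, g @ F --> g l}.
  apply/(pointwise_cvgP (F := g @ F)) => u; exact: (eF u).
move: (gF B (open_nbhs_nbhs (conj oB Bl))).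
by apply: (@filterS _ F _ (g @^-1` B)) => x /BA.
Qed.

Lemma weak_open_open (A : set weak_topology_of) : open A -> open (A : set X).
Proof.
move=> oA; rewrite openE => x Ax.
apply: (@weak_cvg (nbhs x) x); first by move=> u; exact: e_cont.
exact: open_nbhs_nbhs.
Qed.

Section weak_measurability.
Context d (T : measurableType d) (B : nat -> set X).
Hypothesis X_base : base_seq B.

(* The Lindelof property is used twice: to write an open set as a countable
   union of translated polars, and a polar as a countable intersection of strips. *)
Lemma measurable_pairing (G : set T) (f : T -> X) : measurable G ->
  (forall u x, measurable (G `&` [set t | `|e u (f t) - e u x| <= 1])) ->
  measurable_fun G (f : T -> borel X).
Proof.
move=> mG mef.
pose P x E := [set y | pairing_polar E (y - x)].
have mP x E : measurable (G `&` f @^-1` P x E).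
  pose V u := [set y | ~ `|e u y - e u x| <= 1].
  have oV (u : Y) : open (V u).
    rewrite openE => y Vy.
    (* The order of [K] may be partial; the negated inequality can be reversed because both sides
       are real. *)
    have {}Vy : 1 < `|e u y - e u x| by rewrite real_ltNge//; exact/negP.
    have /cvgrPdist_lt/(_ (`|e u y - e u x| - 1)) := @e_cont u y.
    rewrite subr_gt0 => /(_ Vy); apply: filterS => z yz.
    apply/negP; rewrite -real_ltNge//.
    have := ler_distD (e u z) (e u y) (e u x).
    by rewrite -lerBlDl; apply: lt_le_trans; rewrite ltrBrDl -ltrBrDr.
  have [J JP] := @base_seq_lindelof _ _ {u | E u} (fun u => V (sval u)) X_base
    (fun u => oV (sval u)).
  rewrite (_ : _ `&` _ = G `&` \bigcap_n
    (if J n is Some u then G `&` [set t | `|e (sval u) (f t) - e (sval u) x| <= 1]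
     else G)); last first.
    rewrite predeqE => t; split=> [[Gt Pt]|[Gt JG]]; split=> //.
      move=> n _; case: (J n) => [u|//]; split=> //=.
      by rewrite -eB; apply: Pt; exact: (svalP u).
    move=> u Eu; rewrite /= eB; apply: contrapT => nu.
    have [n [[v Ev] [Jn Vv]]] := JP (exist _ u Eu) (f t) nu.
    by have := JG n I; rewrite Jn => -[_]; exact: Vv.
  apply: measurableI => //; apply: bigcapT_measurable => n.
  by case: (J n) => [u|//]; exact: mef.
apply: (@measurability _ _ T (borel X) G f (@open X)) => //.
move=> _ [W oW <-].
have /choice[E EP] : forall x : {x | W x}, exists E,
    nbhs (sval x) (P (sval x) E) /\ P (sval x) E `<=` W.
  by move=> [x Wx]; apply: polar_nbhs; exact: open_nbhs_nbhs.
have [J JP] := @base_seq_lindelof _ _ {x | W x} (fun x => (P (sval x) (E x))°) X_base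
  (fun x => open_interior _).
rewrite (_ : _ `&` _ = \bigcup_n
  (if J n is Some x then G `&` f @^-1` P (sval x) (E x) else set0)); last first.
  rewrite predeqE => t; split=> [[Gt Wt]|[n _]].
    have [n [x [Jn Vx]]] := JP (exist _ (f t) Wt) (f t) (EP (exist _ (f t) Wt)).1.
    by exists n => //; rewrite Jn; split=> //; exact: interior_subset.
  by case: (J n) => // x [Gt Pt]; split=> //; exact: (EP x).2.
apply: bigcupT_measurable => n.
by case: (J n) => [x|//]; exact: mP.
Qed.

End weak_measurability.

Lemma cvg_dist_le (T : Type) (F : set_system T) (f : T -> K) (l c r : K) :
  ProperFilter F -> f @ F --> (l : K^o) -> F [set t | `|f t - c| <= r] ->
  `|l - c| <= r.
Proof.
move=> FF fl Fr.
(* [r] bounds a norm at some point, so it is real and comparable with [|l - c|]. *)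
have r0 : r \is Num.real.
  by have /filter_ex[t /= ftr] := Fr; rewrite ger0_real// (le_trans _ ftr).
rewrite real_leNgt//; apply/negP => rlc.
have /cvgrPdist_lt/(_ (`|l - c| - r)) := fl.
rewrite subr_gt0 => /(_ rlc) Fl.
have /filter_ex[t [/= lt tc]] :
    F ((fun t => `|l - f t| < `|l - c| - r) `&` [set t | `|f t - c| <= r]).
  exact: filterI.
have := ler_distD (f t) l c; rewrite real_leNgt// => /negP; apply.
by rewrite -[ltRHS](subrK r) ltr_leD.
Qed.

Section orbit_limits.
Variables (T : {linear X -> X}) (S : Y -> Y).
Hypothesis cT : continuous T.
Hypothesis eST : forall u x, e (S u) x = e u (T x).
Hypothesis e_lim : forall (y : nat -> X) (F : set_system nat),
  tvs_bounded (range y) -> UltraFilter F ->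
  exists l, forall u, (fun n => e u (y n)) @ F --> e u l.

Lemma sub_tvs_bounded (A B : set X) : A `<=` B -> tvs_bounded B -> tvs_bounded A.
Proof.
by move=> AB bB U /bB[s s0 sB]; exists s => // t /sB; exact: subset_trans.
Qed.

Lemma tvs_bounded_image (E : set X) : tvs_bounded E -> tvs_bounded (T @` E).
Proof.
move=> bE; apply: tvs_boundedP => U U0.
have TU0 : nbhs 0 (T @^-1` U) by apply: cT; rewrite linear0.
have [s s0 sE] := tvs_bounded_eventually bE TU0.
by exists s => // t st _ [x Ex <-]; rewrite -linearZ; exact: sE.
Qed.

Section tower.
Variables (x0 : X) (N0 : set nat).
Hypothesis N0_gt0 : forall n, N0 n -> (0 < n)%N.
Hypothesis N0_bounded : tvs_bounded [set iter n T x0 | n in N0].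

Let orb n := iter n T x0.

Definition shifted j : set nat := [set n | exists2 i, N0 i & n = (i + j)%N].

Lemma shifted_gt0 j n : shifted j n -> (0 < n)%N.
Proof. by move=> [i /N0_gt0 i0 ->]; rewrite addn_gt0 i0. Qed.

Lemma shifted_bounded j : tvs_bounded [set orb n | n in shifted j].
Proof.
elim: j => [|j IHj].
  by apply: sub_tvs_bounded N0_bounded => _ [_ [i Ni ->] <-]; exists i => //; rewrite addn0.
apply: sub_tvs_bounded (tvs_bounded_image IHj) => _ [_ [i Ni ->] <-].
by exists (orb (i + j)); [exists (i + j)%N => //; exists i|rewrite addnS].
Qed.

(** The union over all [j] makes the set stable under the shift, which [stone N0] alone need not
    be. *)
Definition tower : set ultra := \bigcup_j stone (shifted j).

(** The default 0 is harmless: limits are shown to exist on [tower], and only the values there are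
    used. *)
Definition limit_point (p : ultra) : X :=
  xget 0 [set l | forall u, (fun n => e u (orb n)) @ ultra_sets p --> e u l].

Lemma limit_pointP p : tower p ->
  forall u, (fun n => e u (orb n)) @ ultra_sets p --> e u (limit_point p).
Proof.
(* Putting 0 outside [shifted j] makes the whole sequence bounded; since [p] contains [shifted j],
   limits along [p] do not change. *)
move=> [j _ pj]; pose y n := if n \in shifted j then orb n else 0.
have by_ : tvs_bounded (range y).
  apply: sub_tvs_bounded (tvs_boundedU (shifted_bounded j) (@tvs_bounded1 K X 0)).
  move=> _ [n _ <-]; rewrite /y; case: ifPn => [/set_mem jn|_]; last by right.
  by left; exists n.
have [l yl] := e_lim by_ (ultraP p).
apply: (@xgetPex _ 0 [set l | forall u, _ @ ultra_sets p --> e u l]).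
exists l => u; apply: cvg_trans (yl u); apply: near_eq_cvg.
by apply: filterS pj => n jn; rewrite /y mem_set.
Qed.

Lemma limit_point_unique p l : tower p ->
  (forall u, (fun n => e u (orb n)) @ ultra_sets p --> e u l) ->
  limit_point p = l.
Proof.
move=> tp pl; apply: pairing_separates => u.
have FF : ProperFilter ((fun n => e u (orb n)) @ ultra_sets p) by exact: fmap_proper_filter.
apply: (@cvg_unique K^o (@norm_hausdorff K K^o) _ FF); last exact: pl.
exact: limit_pointP.
Qed.

Lemma tower_shift p : tower p -> tower (ultra_shift p).
Proof.
move=> [j _ pj]; exists j.+1 => //; apply: filterS pj => _ [i Ni ->] /=.
by exists i => //; rewrite addnS.
Qed.

(** Testing against [S u] turns [e u (T l)] into the limit of [e u (orb n.+1)], so continuity of [T]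
    for the weak topology is not invoked. *)
Lemma limit_point_shift p : tower p -> limit_point (ultra_shift p) = T (limit_point p).
Proof.
move=> tp; apply: limit_point_unique; first exact: tower_shift.
move=> u; rewrite -eST.
have := @limit_pointP _ tp (S u).
by under eq_fun do rewrite eST.
Qed.

Lemma limit_point_weak_closure p : tower p ->
  @closure weak_topology_of (positive_orbit T x0) (limit_point p).
Proof.
move=> tp A; move: (tp) => [j _ pj].
move/(@weak_cvg (orb @ ultra_sets p) (limit_point p) _ (@limit_pointP _ tp)) => pA.
(* Intersecting with [shifted j] forces [n > 0], as [positive_orbit] starts at 1. *)
have /filter_ex[n [jn An]] : ultra_sets p (shifted j `&` orb @^-1` A).
  exact: filterI.
by exists (orb n); split=> //; exists n => //; exact: shifted_gt0 jn.
Qed.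

Lemma limit_point_polar p E x : stone N0 p ->
  (forall n, N0 n -> pairing_polar E (orb n - x)) ->
  pairing_polar E (limit_point p - x).
Proof.
move=> pN NE u Eu; rewrite eB.
have tp : tower p.
  by exists 0; first by []; apply: filterS pN => n Nn; exists n; rewrite ?addn0.
apply: (cvg_dist_le _ (@limit_pointP _ tp u)).
by apply: filterS pN => n Nn /=; rewrite -eB; exact: NE.
Qed.

Lemma measurable_tower : measurable (tower : set ultra_salgebra).
Proof.
by apply: bigcupT_measurable => j; apply: sub_sigma_algebra; exact: stone_measurable.
Qed.

Lemma measurable_limit_point (B : nat -> set X) : base_seq B ->
  measurable_fun (tower : set ultra_salgebra) (limit_point : ultra -> borel X).
Proof.
move=> X_base; apply: (measurable_pairing X_base) => [|u x]; first exact: measurable_tower.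
(* A limit at distance at most 1 only puts the orbit within [1 + 1 / (k + 1)] along [p]; letting [k]
   vary recovers the exact bound. *)
rewrite (_ : _ `&` _ = tower `&`
  \bigcap_k stone [set n | `|e u (orb n) - e u x| <= 1 + k.+1%:R^-1]).
  apply: measurableI; first exact: measurable_tower.
  by apply: bigcapT_measurable => k; apply: sub_sigma_algebra; exact: stone_measurable.
rewrite predeqE => p; split=> -[tp pk]; split=> //.
  move=> k _ /=.
  have /cvgrPdist_le/(_ k.+1%:R^-1) := @limit_pointP _ tp u.
  rewrite invr_gt0 ltr0n => /(_ isT); apply: filterS => n /= ln.
  by rewrite (le_trans (ler_distD (e u (limit_point p)) _ _))// addrC lerD// distrC.
rewrite /= real_leNgt//; apply/negP => lt1.
have [k] := K_arch (eq_ind_r is_true lt1 (subr_gt0 _ _)).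
rewrite ltrBrDl => /lt_geF/negP; apply.
exact: (cvg_dist_le _ (@limit_pointP _ tp u) (pk k I)).
Qed.

End tower.

(** * Construction of the invariant measures *)

Hypothesis X_sep : separable_space X.

Lemma invariant_measure_of_recurrent (x0 : X) (W : set X) : open W -> W x0 ->
  (RRec R T `&` lbo T) x0 ->
  exists mu : probability (borel X) R,
    [/\ invariant_measure mu T, (0 < mu W)%E &
        mu (~` @closure weak_topology_of (positive_orbit T x0)) = 0%E].
Proof.
move=> oW Wx0 [rx0 [U Ux0 bU]].
have [B X_base] := separable_metrizable_base X_sep X_met.
(* The polar sits inside [W], so that [W] gets charged, and inside [U], so that the orbit is bounded
   along the return times. *)
have [E [Ex0 EWU]] := polar_nbhs (filterI (open_nbhs_nbhs (conj oW Wx0)) Ux0).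
pose N0 := return_times T x0 [set y | pairing_polar E (y - x0)].
have N0_gt0 n : N0 n -> (0 < n)%N by case.
have N0_bounded : tvs_bounded [set iter n T x0 | n in N0].
  apply: sub_tvs_bounded bU => _ [n [n0 En] <-].
  by split; [exact: (EWU _ En).2|exists n].
have [m [m_ge0 mT mU mS mN0]] := invariant_mean (rx0 _ Ex0).
have [nu nuE] := mean_measure m_ge0 mU.
have nuT : nu setT = 1%E by rewrite -stoneT nuE mT.
have nuS (C : set ultra_salgebra) : measurable C -> nu (ultra_shift @^-1` C) = nu C.
  by apply: shift_invariant => [|A]; rewrite ?nuT ?ltry// !nuE mS.
have nu_le (A C : set ultra_salgebra) :
    measurable A -> measurable C -> A `<=` C -> (nu A <= nu C)%E.
  by move=> mA mC; apply: (le_measure nu); rewrite inE.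
pose G : set ultra_salgebra := tower N0.
pose pi : ultra_salgebra -> borel X := limit_point x0.
have mG : measurable G by exact: measurable_tower.
have mpi : measurable_fun G pi by exact: measurable_limit_point X_base.
have mstone A : measurable (stone A : set ultra_salgebra).
  by apply: sub_sigma_algebra; exact: stone_measurable.
have N0G : stone N0 `<=` G.
  by move=> p pN; exists 0 => //; apply: filterS pN => n Nn; exists n; rewrite ?addn0.
have nuN0 : (0 < nu (stone N0))%E by rewrite nuE lte_fin.
have nuG0 : (0 < nu G)%E.
  by apply: (lt_le_trans nuN0); exact: nu_le.
have nuGoo : (nu G < +oo)%E.
  apply: (@le_lt_trans _ _ (nu setT)); last by rewrite nuT ltry.
  exact: nu_le.
have [mu muE] := restricted_image_probability mG mpi nuG0 nuGoo.
exists mu; split.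
- move=> A mA; rewrite !muE; congr (_ * _)%E.
  have mGA : measurable (G `&` pi @^-1` A) by exact: mpi.
  have mshift (C : set ultra_salgebra) : measurable C ->
      measurable (ultra_shift @^-1` C : set ultra_salgebra).
    by move=> mC; rewrite -[X in measurable X]setTI; exact: measurable_ultra_shift.
  rewrite -(nuS _ mGA).
  (* On [G], [pi] intertwines the shift with [T], which reduces invariance of [mu] to that of
     [nu]. *)
  have -> : G `&` pi @^-1` (T @^-1` A) =
      ultra_shift @^-1` (G `&` pi @^-1` A) `&` G.
    rewrite predeqE => p; split=> [[Gp Ap]|[[_ Ap] Gp]]; split=> //.
      by split; [exact: tower_shift|rewrite /= /pi (limit_point_shift N0_bounded)].
    by move: Ap; rewrite /= /pi (limit_point_shift N0_bounded).
  (* G is contained in its preimage under the shift, which has the same measure. *)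
  have shGD : nu (ultra_shift @^-1` G `\` G) = 0%E.
    have nuGG : (nu (ultra_shift @^-1` G) < +oo)%E by rewrite nuS.
    apply: etrans (@measureD _ _ _ nu _ _ (mshift _ mG) mG nuGG) _.
    rewrite setIidr => [|p]; last exact: tower_shift.
    by rewrite -[X in (_ - X)%E](nuS _ mG) subee// ge0_fin_numE.
  (* The shifted preimage splits into its part in [G] and a part outside, contained in the null set
     of [shGD]. *)
  apply: etrans (measureDI nu (mshift _ mGA) mG) _.
  rewrite [X in (X + _)%E](_ : _ = 0%E) ?add0e//; apply/eqP; rewrite -measure_le0 -shGD.
  apply: nu_le.
  - by apply: measurableD => //; exact: mshift.
  - by apply: measurableD => //; exact: mshift.
  - by apply: setSD => p [].
- rewrite muE mule_gt0//; last first.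
    by rewrite lte_fin invr_gt0 fine_gt0// nuG0.
  apply: (lt_le_trans nuN0); apply: nu_le => //.
    by apply: mpi => //; apply: sub_sigma_algebra.
  move=> p pN; split; first exact: N0G.
  have piE : pairing_polar E (pi p - x0).
    by apply: limit_point_polar pN _ => // n [].
  exact: (EWU _ piE).1.
- have G0 : G `&` pi @^-1` (~` @closure weak_topology_of (positive_orbit T x0)) = set0.
    apply/seteqP; split=> // p [Gp]; apply.
    exact: limit_point_weak_closure Gp.
  by rewrite muE (etrans (congr1 nu G0) (measure0 nu)) mul0e.
Qed.

Let open_measurable (U : set X) : open U -> measurable (U : set (borel X)).
Proof. exact: sub_sigma_algebra. Qed.

Lemma recurrent_invariant_measure (x0 : X) : (RRec R T `&` lbo T) x0 ->
  exists mu : probability (borel X) R,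
    [/\ invariant_measure mu T, measure_support mu x0,
        measure_support mu `<=` @closure weak_topology_of (positive_orbit T x0) &
        x0 <> 0 -> nontrivial_measure mu].
Proof.
move=> rx0; have [B X_base] := separable_metrizable_base X_sep X_met.
(* Each basic neighbourhood of [x0] gets a measure charging it; for the other indices the measure
   obtained from the whole space is a filler. *)
have /choice[mu mu_inv] : forall n, exists mu : probability (borel X) R,
    [/\ invariant_measure mu T, B n x0 -> (0 < mu (B n))%E &
        mu (~` @closure weak_topology_of (positive_orbit T x0)) = 0%E].
  move=> n; have [Bx0|nBx0] := pselect (B n x0).
    have [mu [? ? ?]] := invariant_measure_of_recurrent (X_base.1 n) Bx0 rx0.
    by exists mu.
  have [mu [? ? ?]] := invariant_measure_of_recurrent openT I rx0.
  by exists mu.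
have [P [PE P0 P_gt0]] := countable_mixture mu.
have supp_x0 : measure_support P x0.
  move=> [U [oU PU0] Ux0].
  have [n [Bx0 BU]] := X_base.2 _ _ (open_nbhs_nbhs (conj oU Ux0)).
  have : (0 < P U)%E.
    apply: (P_gt0 n); first exact: open_measurable.
    have [_ /(_ Bx0) Bn _] := mu_inv n.
    apply: (lt_le_trans Bn); apply: (le_measure (mu n)) => //; rewrite inE.
      exact: open_measurable (X_base.1 n).
    exact: open_measurable.
  by rewrite PU0 ltxx.
exists P; split=> //.
- by move=> A mA; apply: PE => n; have [inv _ _] := mu_inv n; exact: inv.
- move=> x suppx; apply: contrapT => ncx; apply: suppx.
  exists (~` @closure weak_topology_of (positive_orbit T x0)) => //; split.
    apply: weak_open_open; apply: closed_openC; exact: closed_closure.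
  by apply: P0 => n; have [] := mu_inv n.
(* Were [P] the Dirac mass at 0, an open neighbourhood of [x0] missing 0 would be null, against [x0]
   being in the support. *)
- move=> x00 Pdirac; apply: supp_x0.
  have [U Ux0 nU0] := completely_metrizable_T1 X_met x00.
  exists U° => //; split; first exact: open_interior.
  rewrite Pdirac; last by apply: open_measurable; exact: open_interior.
  by rewrite diracE memNset// => /interior_subset.
Qed.

Lemma dense_recurrent_invariant_measure : dense (RRec R T `&` lbo T) ->
  exists mu : probability (borel X) R, invariant_measure mu T /\ full_support mu.
Proof.
move=> dR; have [B X_base] := separable_metrizable_base X_sep X_met.
have /choice[mu mu_inv] : forall n, exists mu : probability (borel X) R,
    invariant_measure mu T /\ (B n !=set0 -> (0 < mu (B n))%E).
  move=> n; have [Bn|nBn] := pselect (B n !=set0).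
    have [x [Bx rx]] := dR _ Bn (X_base.1 n).
    have [mu [? ? _]] := invariant_measure_of_recurrent (X_base.1 n) Bx rx.
    by exists mu.
  (* Filler for empty basic sets: density provides at least one recurrent vector. *)
  have [x [_ rx]] := dR setT (ex_intro _ 0 I) openT.
  have [mu [? _ _]] := invariant_measure_of_recurrent openT I rx.
  by exists mu.
have [P [PE P0 P_gt0]] := countable_mixture mu.
exists P; split.
  by move=> A mA; apply: PE => n; have [inv _] := mu_inv n; exact: inv.
move=> U oU [x Ux].
have [n [Bx BU]] := X_base.2 _ _ (open_nbhs_nbhs (conj oU Ux)).
apply: (P_gt0 n); first exact: open_measurable.
have [_ Bn] := mu_inv n.
apply: (lt_le_trans (Bn (ex_intro _ x Bx))).
apply: (le_measure (mu n)) => //; rewrite inE.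
  exact: open_measurable (X_base.1 n).
exact: open_measurable.
Qed.

End orbit_limits.

End weak_pairing.

(** * Strong duals and reflexive spaces *)

Section scalars.
Variables (R : realType) (K : numFieldType).
Hypothesis RC : real_or_complex R K.

Lemma scalars_archimedean (r : K) : 0 < r -> exists k : nat, k.+1%:R^-1 < r.
Proof.
have Rarch (s : R) : 0 < s -> exists k : nat, k.+1%:R^-1 < s.
  move=> s0; have [k _ /(_ _ (leqnn k))] := near_infty_natSinv_lt (PosNum s0).
  by exists k.
(* In the order of [R[i]], [0 < r] forces the imaginary part of [r] to vanish. *)
case: K / RC r => // -[a b]; rewrite ltcE /= => /andP[/eqP -> /Rarch[k ka]].
exists k; rewrite -(rmorph_nat (real_complex R)) -fmorphV ltcE /= eqxx.
exact: ka.
Qed.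

Lemma scalars_ultra_cvg (T : Type) (F : set_system T) (f : T -> K) (M : K) :
  UltraFilter F -> (forall t, `|f t| <= M) -> exists l : K^o, f @ F --> l.
Proof.
move=> FU; case: K / RC f M => [f M fM|f [M N] fM].
  exists (lim (f @ F)); apply: (@ultra_cvg_itv _ _ _ _ (- M) M).
  by apply: filterS filterT => t _ /=; rewrite -ler_norml.
have sqrtM (x y : R) : Num.sqrt (x ^+ 2 + y ^+ 2) <= M -> `|x| <= M /\ `|y| <= M.
  move=> xyM; split; apply: le_trans xyM; rewrite -sqrtr_sqr ler_wsqrtr//.
    by rewrite lerDl sqr_ge0.
  by rewrite lerDr sqr_ge0.
have {}fM t : `|complex.Re (f t)| <= M /\ `|complex.Im (f t)| <= M.
  by apply: sqrtM; have := fM t; rewrite normc_def lecE => /andP[].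
have reF : cvg ((fun t => complex.Re (f t)) @ F).
  apply: (@ultra_cvg_itv _ _ _ _ (- M) M).
  by apply: filterS filterT => t _ /=; rewrite -ler_norml; exact: (fM t).1.
have imF : cvg ((fun t => complex.Im (f t)) @ F).
  apply: (@ultra_cvg_itv _ _ _ _ (- M) M).
  by apply: filterS filterT => t _ /=; rewrite -ler_norml; exact: (fM t).2.
set a := lim _ in reF; set b := lim _ in imF.
exists ((a +i* b)%C : R[i]^o); apply/cvgrPdist_lt => -[r i].
rewrite ltcE /= => /andP[/eqP -> r0].
have r20 : 0 < r / 2 by rewrite divr_gt0.
have /cvgrPdist_lt/(_ _ r20) reFr := reF.
have /cvgrPdist_lt/(_ _ r20) imFr := imF.
apply: filterS2 reFr imFr => t; case: (f t) => x y /= ax by_.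
rewrite normc_def ltcE /= eqxx /=.
apply: (@le_lt_trans _ _ (`|a - x| + `|b - y|)); last by rewrite (splitr r) ltrD.
rewrite -[leRHS]ger0_norm ?addr_ge0// -[leRHS]sqrtr_sqr ler_wsqrtr//.
rewrite -[(a - x) ^+ 2]real_normK ?num_real// -[(b - y) ^+ 2]real_normK ?num_real//.
by rewrite sqrrD lerD2r lerDl mulrn_wge0// mulr_ge0.
Qed.

(** An argument of Alaoglu type: the pointwise limit is linear by uniqueness of limits, and
    continuous because the equicontinuity estimates pass to the limit. *)
Lemma equicontinuous_ultralimit (Y : tvsType K) (x : nat -> strong_dual Y)
    (F : set_system nat) : UltraFilter F ->
  (forall u, exists M, forall n, `|x n u| <= M) ->
  equicontinuous [set: nat] (fun n => x n : Y -> K^o) ->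
  exists l : strong_dual Y, forall u, (fun n => x n u : K^o) @ F --> l u.
Proof.
move=> FU xM eqx.
have /choice[L xL] : forall u, exists l : K^o, (fun n => x n u : K^o) @ F --> l.
  by move=> u; have [M ?] := xM u; exact: scalars_ultra_cvg.
have Llin : linear (L : Y -> K^o).
  move=> a u v; apply: (@cvg_unique K^o (@norm_hausdorff K K^o) _ _ _ _ (xL _)).
  rewrite (_ : (fun n => _) = (fun n => a *: (x n u : K^o)) \+ (fun n => x n v)).
    by apply: (@cvgD K K^o nat F) => //; apply: (@cvgZl_tmp K K^o nat F).
  by apply/funext => n; rewrite /= dual_linear.
have Lcont : continuous (L : Y -> K^o).
  move=> u; apply/cvgrPdist_le => r r0.
  have := eqx u _ (entourage_ball (K^o) (PosNum r0)).
  apply: filterS => v xuv.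
  rewrite -[L u - L v]subr0.
  apply: (@cvg_dist_le K _ F (fun n => x n u - x n v)); first exact: cvgB.
  by apply: filterS filterT => n _ /=; rewrite subr0 ltW//; exact: (xuv n I).
have LP : (L : Y -> K^o) \in @dual_pred K Y by apply/asboolP.
by exists (Dual LP).
Qed.

End scalars.

Section duals.
Variables (K : numFieldType) (Y : tvsType K).

Lemma pointwise_bounded (x : nat -> strong_dual Y) u : tvs_bounded (range x) ->
  exists M, forall n, `|x n u| <= M.
Proof.
move=> bx; have U0 : nbhs 0 (polar [set u]).
  by apply/nbhs0_strong_dual; exists [set u] => //; exact: tvs_bounded1.
have [s s0 sx] := tvs_bounded_eventually bx U0.
exists s => n; have := sx s; rewrite (gtr0_norm s0) => /(_ (lexx _) (x n)).
move=> /(_ (ex_intro2 _ _ n I erefl) u erefl).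
by rewrite dual_scaleE normrM normfV (gtr0_norm s0) ler_pdivrMl// mulr1.
Qed.

Lemma dual_pairing_continuous (u : Y) :
  continuous (fun x : strong_dual Y => x u : K^o).
Proof. by have /asboolP[_] := eval_in_dual u. Qed.

Lemma polar_nbhs0 (W : set (strong_dual Y)) : nbhs 0 W ->
  exists E, nbhs 0 (polar E) /\ polar E `<=` W.
Proof.
move=> /nbhs0_strong_dual[E bE EW]; exists E; split=> //.
by apply/nbhs0_strong_dual; exists E.
Qed.

End duals.

Section reflexive_space.
Variables (K : numFieldType) (X : tvsType K).

Lemma transpose_in_dual (T : {linear X -> X}) (cT : continuous T)
  (f : strong_dual X) : (fun x => f (T x)) \in @dual_pred K X.
Proof.
apply/asboolP; split; first by move=> a x y; rewrite !linearP.
by move=> x; apply: (continuous_comp (cT x)); exact: dual_continuous.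
Qed.

(** Takes the place of quasi-barrelledness in the reflexive case: the polar of a multiple of the
    bounded range is a strong neighbourhood on which all [x n] are uniformly small. *)
Lemma bidual_equicontinuous (x : nat -> X) : tvs_bounded (range x) ->
  equicontinuous [set: nat] (fun n => bidual_inclusion (x n) : strong_dual X -> K^o).
Proof.
move=> bx f A; rewrite -entourage_from_ballE => -[r /= r0 rA].
have r20 : 0 < r / 2 by rewrite divr_gt0.
exists ( *:%R (r / 2)^-1 @` range x); first exact: tvs_boundedZ.
move=> g fg n _; apply: rA => /=; rewrite -ball_normE /=.
have /fg : ( *:%R (r / 2)^-1 @` range x) ((r / 2)^-1 *: x n) by exists (x n) => //; exists n.
rewrite linearZ normrM gtr0_norm ?invr_gt0// ler_pdivrMl// mulr1 => gfr.
by rewrite distrC (le_lt_trans gfr)// ltr_pdivrMr// ltr_pMr// ltr1n.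
Qed.

(** The set is the preimage of a bidual polar under the canonical inclusion: a neighbourhood since
    the inclusion is continuous, small since its inverse [g] is. *)
Lemma reflexive_polar_nbhs0 (W : set X) : reflexive_tvs X -> nbhs 0 W ->
  exists E : set (strong_dual X),
    nbhs 0 [set x : X | forall f, E f -> `|f x| <= 1] /\
    [set x : X | forall f, E f -> `|f x| <= 1] `<=` W.
Proof.
move=> [g [gK Kg cJ cg]] W0.
have gW : nbhs 0 (g @^-1` W).
  by apply: cg; rewrite -[0 : strong_dual _](linear0 (@bidual_inclusion K X)) gK.
have [E [E0 EW]] := polar_nbhs0 gW.
exists E; split; last by move=> x Ex; rewrite -(gK x); apply: EW.
have := cJ 0 (polar E); rewrite linear0; exact.
Qed.

End reflexive_space.
Theorem theorem2p3 (R : realType) (K : numFieldType)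
    (K_real_or_complex : real_or_complex R K) :
  (forall Y : tvsType K,
     hausdorff_space Y ->
     quasi_linfty_barrelled Y ->
     separable_space (strong_dual Y) ->
     frechet_space R (strong_dual Y) ->
     forall T : {linear strong_dual Y -> strong_dual Y},
     continuous T ->
     (exists S : {linear Y -> Y},
        forall (u : Y) (x : strong_dual Y), x (S u) = T x u) ->
     (forall x0 : strong_dual Y, (RRec R T `&` lbo T) x0 ->
        exists mu : probability (borel (strong_dual Y)) R,
          [/\ invariant_measure mu T,
              measure_support mu x0,
              measure_support mu `<=` @closure (weak_star_topology Y) (positive_orbit T x0)
            & x0 <> 0 -> nontrivial_measure mu])
     /\
     (dense (RRec R T `&` lbo T) ->
        exists mu : probability (borel (strong_dual Y)) R,
          invariant_measure mu T /\ full_support mu))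
  /\
  (forall X : tvsType K,
     separable_space X ->
     frechet_space R X ->
     reflexive_tvs X ->
     forall T : {linear X -> X},
     continuous T ->
     (forall x0 : X, (RRec R T `&` lbo T) x0 ->
        exists mu : probability (borel X) R,
          [/\ invariant_measure mu T,
              measure_support mu x0,
              measure_support mu `<=` @closure (sigma_topology X) (positive_orbit T x0)
            & x0 <> 0 -> nontrivial_measure mu])
     /\
     (dense (RRec R T `&` lbo T) ->
        exists mu : probability (borel X) R,
          invariant_measure mu T /\ full_support mu)).
Proof.
have K_arch := scalars_archimedean K_real_or_complex.
split.
- move=> Y _ Yqb Xsep Xmet T cT [S ST].
  have e_lim (y : nat -> strong_dual Y) (F : set_system nat) :
      tvs_bounded (range y) -> UltraFilter F ->
      exists l : strong_dual Y, forall u : Y, (fun n => y n u : K^o) @ F --> l u.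
    move=> yb FU; apply: (equicontinuous_ultralimit K_real_or_complex) (Yqb y yb).
    by move=> u; exact: pointwise_bounded.
  have eB (u : Y) (x y : strong_dual Y) : (x - y) u = x u - y u by [].
  split=> [x0 rx0|].
    exact: (@recurrent_invariant_measure R K _ Y (fun u (x : strong_dual Y) => x u) K_arch eB
      (@dual_pairing_continuous K Y) (@polar_nbhs0 K Y) Xmet T S cT ST e_lim
      Xsep x0 rx0).
  exact: (@dense_recurrent_invariant_measure R K _ Y (fun u (x : strong_dual Y) => x u) K_arch eB
    (@dual_pairing_continuous K Y) (@polar_nbhs0 K Y) Xmet T S cT ST e_lim Xsep).
move=> X Xsep Xmet Xrefl T cT; have [g [_ Kg _ _]] := Xrefl.
(* The limit is first found in the bidual, then brought back to [X] by surjectivity of the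
   inclusion. *)
have e_lim (y : nat -> X) (F : set_system nat) :
    tvs_bounded (range y) -> UltraFilter F ->
    exists l : X, forall f : strong_dual X, (fun n => f (y n) : K^o) @ F --> f l.
  move=> yb FU; have eqy := bidual_equicontinuous yb.
  have [|l yl] := equicontinuous_ultralimit K_real_or_complex FU _ eqy.
    move=> f; have [M _ fM] := dual_bounded f yb.
    by exists M => n; apply: fM; exists n.
  by exists (g l) => f; rewrite -[f (g l)]/(bidual_inclusion (g l) f) Kg; exact: yl.
have eB (f : strong_dual X) (x y : X) : f (x - y) = f x - f y by exact: linearB.
(* The transpose of [T] on the dual; the adjoint identity then holds by computation. *)
pose S (f : strong_dual X) := Dual (transpose_in_dual cT f).
have e_nbhs (W : set X) : nbhs 0 W -> _ := reflexive_polar_nbhs0 Xrefl.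
split=> [x0 rx0|].
  exact: (@recurrent_invariant_measure R K X (strong_dual X) (fun (f : strong_dual X) x => f x)
    K_arch eB (@dual_continuous K X) e_nbhs Xmet T S cT (fun _ _ => erefl) e_lim
    Xsep x0 rx0).
exact: (@dense_recurrent_invariant_measure R K X (strong_dual X) (fun (f : strong_dual X) x => f x)
  K_arch eB (@dual_continuous K X) e_nbhs Xmet T S cT (fun _ _ => erefl) e_lim Xsep).
Qed.
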